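(* Let $E$ be a finite homogeneous effect algebra. If $S(E)=\{0,1\}$, then $E$ (with its canonical partial order) is a lattice.
   Context: An effect algebra is a set $E$ with two elements $0,1\in E$ and a partial binary operation $\oplus$ such that: (i) if $x\oplus y$ is defined then $y\oplus x$ is defined and $x\oplus y=y\oplus x$; (ii) if $x\oplus y$ and $(x\oplus y)\oplus z$ are defined then $y\oplus z$ and $x\oplus(y\oplus z)$ are defined and $(x\oplus y)\oplus z=x\oplus(y\oplus z)$; (iii) for each $x\in E$ there is a unique $x'\in E$ with $x\oplus x'$ defined and equal to $1$; (iv) if $x\oplus 1$ is defined then $x=0$. Write $x\perp y$ if $x\oplus y$ is defined, and $x\le y$ if there is $z\in E$ with $x\oplus z=y$; this canonical relation is a partial order with least element $0$ and greatest element $1$, and $x\perp y$ iff $x\le y'$. The set of sharp elements is $S(E)=\{x\in E: x\wedge x'=0\}$, i.e. those $x$ for which $0$ is the only element below both $x$ and $x'$. $E$ is homogeneous if whenever $u,v_1,v_2\in E$ satisfy $v_1\perp v_2$ and $u\le v_1\oplus v_2\le u'$, there exist $u_1,u_2\in E$ with $u_1\le v_1$, $u_2\le v_2$, $u_1\perp u_2$ and $u=u_1\oplus u_2$. *)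

(* Defs.v *)
From mathcomp Require Import all_boot.
From Stdlib Require Import Relation_Definitions.

Set Implicit Arguments.
Unset Strict Implicit.
Unset Printing Implicit Defensive.

(* [oplus x y = Some z] reads "x (+) y is defined and equal to z". The case
   [ea_zero = ea_one] (a one-element algebra) is not excluded by the axioms. *)
Record effectAlgebra (T : choiceType) := EffectAlgebra {
  ea_zero : T;
  ea_one : T;
  oplus : T -> T -> option T;
  oplusC : forall x y z, oplus x y = Some z -> oplus y x = Some z;
  oplusA : forall x y z xy xyz, oplus x y = Some xy -> oplus xy z = Some xyz ->
    exists yz, oplus y z = Some yz /\ oplus x yz = Some xyz;
  oplus_supp : forall x, exists! x', oplus x x' = Some ea_one;
  oplus_one : forall x, isSome (oplus x ea_one) -> x = ea_zero
}.

Arguments ea_zero {T} E : rename.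
Arguments ea_one {T} E : rename.
Arguments oplus {T} E x y : rename.

Section Poset.
Context (T : Type) (le : T -> T -> Prop).

Definition is_meet (x y m : T) : Prop :=
  [/\ le m x, le m y & forall z, le z x -> le z y -> le z m].

Definition is_join (x y j : T) : Prop :=
  [/\ le x j, le y j & forall z, le x z -> le y z -> le j z].

Definition is_lattice : Prop :=
  order T le /\
  forall x y, (exists m, is_meet x y m) /\ (exists j, is_join x y j).

End Poset.

Section EffectAlgebra.
Context (T : choiceType) (E : effectAlgebra T).
Implicit Types x y z u v : T.

Definition perp x y : Prop := isSome (oplus E x y).

Definition ea_le x y : Prop := exists z, oplus E x z = Some y.

Fact supp_ex x : exists x', oplus E x x' == Some (ea_one E).
Proof. by have [y [/eqP xy _]] := oplus_supp E x; exists y. Qed.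

Definition supp x : T := xchoose (supp_ex x).

Definition sharp x : Prop := is_meet ea_le x (supp x) (ea_zero E).

Definition homogeneous : Prop :=
  forall u v1 v2 w, oplus E v1 v2 = Some w -> ea_le u w -> ea_le w (supp u) ->
  exists u1 u2, [/\ ea_le u1 v1, ea_le u2 v2 & oplus E u1 u2 = Some u].

Lemma oplus_suppE x y : oplus E x y = Some (ea_one E) <-> y = supp x.
Proof.
have sx : oplus E x (supp x) = Some (ea_one E).
  exact/eqP/(xchooseP (supp_ex x)).
split=> [xy|->//]; have [z [_ uz]] := oplus_supp E x.
by rewrite -(uz _ xy) (uz _ sx).
Qed.

Lemma suppK : involutive supp.
Proof. by move=> x; apply/esym/oplus_suppE/oplusC/oplus_suppE. Qed.

Lemma supp_one : supp (ea_one E) = ea_zero E.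
Proof.
apply: (@oplus_one _ E).
by have/oplusC-> : oplus E (ea_one E) (supp (ea_one E)) = Some (ea_one E)
  by apply/oplus_suppE.
Qed.

Lemma oplus0 x : oplus E x (ea_zero E) = Some x.
Proof.
have s1 : oplus E (ea_one E) (ea_zero E) = Some (ea_one E).
  by apply/oplus_suppE; rewrite supp_one.
have sx : oplus E (supp x) x = Some (ea_one E) by apply/oplus_suppE; rewrite suppK.
have [y [xy /oplus_suppE]] := oplusA sx s1.
by rewrite suppK xy => ->.
Qed.

Lemma oplusI x y z w : oplus E x y = Some w -> oplus E x z = Some w -> y = z.
Proof.
have key t : oplus E x t = Some w ->
    exists2 r, oplus E (supp w) x = Some r & t = supp r.
  move=> xt; have sw : oplus E (supp w) w = Some (ea_one E).
    by apply/oplus_suppE; rewrite suppK.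
  have [s [ts /oplus_suppE sE]] := oplusA xt (oplusC sw).
  have tx := oplusC xt; have /oplusC sw' := sw.
  have [r [xr tr]] := oplusA tx sw'.
  by exists r; [exact: oplusC | apply/oplus_suppE/oplusC].
by move=> /key[r er ->] /key[r']; rewrite er => -[->] ->.
Qed.

Lemma oplus_eq0 x y : oplus E x y = Some (ea_zero E) -> x = ea_zero E.
Proof.
move=> xy; have [z [yz _]] := oplusA xy (oplusC (oplus0 (ea_one E))).
have/oplus_one y0 : isSome (oplus E y (ea_one E)) by rewrite yz.
by move: xy; rewrite y0 oplus0 => -[].
Qed.

Lemma ea_le_order : order T ea_le.
Proof.
split.
- by move=> x; exists (ea_zero E); apply: oplus0.
- move=> x y z [a xa] [b yb]; have [c [_ xc]] := oplusA xa yb; by exists c.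
- move=> x y [a xa] [b yb]; have [c [ab xc]] := oplusA xa yb.
  have c0 := oplusI xc (oplus0 x); rewrite c0 in ab.
  by move: xa; rewrite (oplus_eq0 ab) oplus0 => -[].
Qed.

Lemma ea_le0 x : ea_le (ea_zero E) x.
Proof. by exists x; apply/oplusC/oplus0. Qed.

Lemma ea_le1 x : ea_le x (ea_one E).
Proof. by exists (supp x); apply/oplus_suppE. Qed.

Lemma perpE x y : perp x y <-> ea_le x (supp y).
Proof.
split; rewrite /perp.
  case xy: (oplus E x y) => [w|//] _.
  have ws : oplus E w (supp w) = Some (ea_one E) by apply/oplus_suppE.
  have [z [xz /oplus_suppE zE]] := oplusA (oplusC xy) ws.
  by exists (supp w); rewrite xz zE.
move=> [z xz]; have sy : oplus E (supp y) y = Some (ea_one E).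
  by apply/oplus_suppE; rewrite suppK.
have [w [xy _]] := oplusA (oplusC xz) sy.
by rewrite xy.
Qed.

End EffectAlgebra.

(* Main.v *)
Require Import Defs.
From HB Require Import structures.
From mathcomp Require Import all_boot.

(** Since no element other than 0 and 1 is sharp, a maximal orthogonal sum of
    atoms taken (with repetition) from a given nonempty set is 1: by
    homogeneity, an atom below such a sum [w] and below [w'] is one of the
    summands, so the sum could be enlarged. Applied to two orthogonal atoms
    [a <> b] this gives [i a (+) j b = 1], and the complements [i a], [j b] are
    each a multiple of both [a] and [b], hence comparable; the smaller one is
    orthogonal to itself, and homogeneity forces [a = b]. So orthogonal atoms
    are equal, every element is a multiple of an atom, and that atom is unique
    except for the element 1. Hence two incomparable elements have meet 0 and
    join 1. *)

Set Implicit Arguments.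
Unset Strict Implicit.
Unset Printing Implicit Defensive.

(** * Finite orthogonal sums, the order, and atoms under homogeneity *)

Section OptionMonoid.
Context (T : choiceType) (E : effectAlgebra T).

(* Totalizing the partial sum on [option T], with [None] absorbing, gives a
   commutative monoid, so that finite orthogonal sums are big operators. *)
Definition oadd (x y : option T) : option T :=
  obind (fun a => obind (oplus E a) y) x.

Lemma oplus_comm x y : oplus E x y = oplus E y x.
Proof.
case xy: (oplus E x y) => [z|]; first by rewrite (oplusC xy).
by case yx: (oplus E y x) => [z|//]; rewrite (oplusC yx) in xy.
Qed.

Lemma oaddC : commutative oadd.
Proof. by move=> [x|] [y|] //=; apply: oplus_comm. Qed.

Lemma oadd_assoc_Some x y z w : oadd (oadd x y) z = Some w ->
  oadd x (oadd y z) = Some w.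
Proof.
case: x y z => [x|] [y|] [z|] //=; case xy: (oplus E x y) => [v|] //= vz.
by have [u [-> /= ->]] := oplusA xy vz.
Qed.

Lemma oaddA : associative oadd.
Proof.
move=> x y z; case e: (oadd (oadd x y) z) => [w|]; first exact: oadd_assoc_Some.
(* The axiom only moves brackets to the right; commutativity gives the opposite direction. *)
case f: (oadd x (oadd y z)) => [w|//].
rewrite -e oaddC [oadd x y]oaddC; apply/esym/oadd_assoc_Some.
by rewrite oaddC [oadd z y]oaddC.
Qed.

Lemma oadd0 : left_id (Some (ea_zero E)) oadd.
Proof. by move=> [x|//] /=; rewrite oplus_comm oplus0. Qed.

HB.instance Definition _ :=
  Monoid.isComLaw.Build (option T) (Some (ea_zero E)) oadd oaddA oaddC oadd0.

Definition osum (s : seq T) : option T :=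
  \big[oadd/Some (ea_zero E)]_(a <- s) Some a.

Lemma osum_nil : osum [::] = Some (ea_zero E).
Proof. exact: big_nil. Qed.

Lemma osum_cons a s : osum (a :: s) = oadd (Some a) (osum s).
Proof. exact: big_cons. Qed.

Lemma osum_cat s t : osum (s ++ t) = oadd (osum s) (osum t).
Proof. exact: big_cat. Qed.

Lemma osum_perm s t : perm_eq s t -> osum s = osum t.
Proof. exact: perm_big. Qed.

Lemma osum_catP s t w : osum (s ++ t) = Some w ->
  exists u v, [/\ osum s = Some u, osum t = Some v & oplus E u v = Some w].
Proof.
rewrite osum_cat; case: (osum s) (osum t) => [u|] [v|] //= uv.
by exists u, v.
Qed.

Lemma osum_consP a s w : osum (a :: s) = Some w ->
  exists2 v, osum s = Some v & oplus E a v = Some w.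
Proof. by rewrite osum_cons /=; case: (osum s) => [v|] //= av; exists v. Qed.

Lemma ea_le_refl x : ea_le E x x.
Proof. by have [r _ _] := ea_le_order E; apply: r. Qed.

Lemma ea_le_trans y x z : ea_le E x y -> ea_le E y z -> ea_le E x z.
Proof. by have [_ t _] := ea_le_order E; apply: t. Qed.

Lemma ea_le_anti x y : ea_le E x y -> ea_le E y x -> x = y.
Proof. by have [_ _ a] := ea_le_order E; apply: a. Qed.

Lemma ea_le_zero x : ea_le E x (ea_zero E) -> x = ea_zero E.
Proof. by move=> x0; apply: ea_le_anti x0 (ea_le0 _ _). Qed.

Lemma oplus_lel x y z : oplus E x y = Some z -> ea_le E x z.
Proof. by exists y. Qed.

Lemma oplus_ler x y z : oplus E x y = Some z -> ea_le E y z.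
Proof. by move/oplusC; exists x. Qed.

Lemma perpC x y : perp E x y -> perp E y x.
Proof. by rewrite /perp oplus_comm. Qed.

Lemma perp_le x y u v : ea_le E u x -> ea_le E v y -> perp E x y -> perp E u v.
Proof.
move=> ux vy /perpE xy; apply/perpE/(ea_le_trans ux).
apply/perpE/perpC/perpE/(ea_le_trans vy).
exact/perpE/perpC/perpE.
Qed.

Lemma osum_mem_le a s w : a \in s -> osum s = Some w -> ea_le E a w.
Proof.
move=> /perm_to_rem/osum_perm -> /osum_consP[v _]; exact: oplus_lel.
Qed.

Lemma osum_nseq_le a i j u v : i <= j ->
  osum (nseq i a) = Some u -> osum (nseq j a) = Some v -> ea_le E u v.
Proof.
move=> ij ui; rewrite -(subnKC ij) nseqD => /osum_catP[u' [v' []]].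
by rewrite ui => -[<-] _; apply: oplus_lel.
Qed.

Lemma osum_nseq_total a i j u v :
  osum (nseq i a) = Some u -> osum (nseq j a) = Some v ->
  ea_le E u v \/ ea_le E v u.
Proof.
move=> ui vj; case/orP: (leq_total i j) => ij.
  by left; apply: osum_nseq_le ij ui vj.
by right; apply: osum_nseq_le ij vj ui.
Qed.

Definition atom a : Prop :=
  a <> ea_zero E /\ forall x, ea_le E x a -> x = ea_zero E \/ x = a.

Lemma atom_le_atom a b : atom a -> atom b -> ea_le E a b -> a = b.
Proof. by move=> [a0 _] [_ bE] /bE[]. Qed.

(** Homogeneity splits [c] along [w = a (+) v], and an atom splits only trivially: either [c] lies
    below [a], hence equals it, or [c] lies below [v] and induction on [s] applies. *)
Lemma homogeneous_atom_mem s c w : homogeneous E -> atom c ->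
  {in s, forall a, atom a} -> osum s = Some w ->
  ea_le E c w -> perp E w c -> c \in s.
Proof.
move=> homE cA; elim: s w => [|a s IH] w sA.
  by rewrite osum_nil => -[<-] /ea_le_zero; case: cA.
move=> /osum_consP[v sv av] cw wc.
have [u1 [u2 [u1a u2v u12]]] := homE c a v w av cw ((perpE _ _ _).1 wc).
have aA : atom a by apply: sA; rewrite mem_head.
have [u10|u1c] := cA.2 u1 (oplus_lel u12); last first.
  by rewrite u1c in u1a; rewrite (atom_le_atom cA aA u1a) mem_head.
move: u12; rewrite u10 oplus_comm oplus0 => -[u2c].
rewrite inE (IH v) ?orbT //.
- by move=> b bs; apply: sA; rewrite inE bs orbT.
- by rewrite -u2c.
- exact: perp_le (oplus_ler av) (ea_le_refl c) wc.
Qed.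

End OptionMonoid.

(** * Well-founded induction and existence of atoms in the finite case *)

Section Finite.
Context (T : finType) (E : effectAlgebra T).
Local Notation "0" := (ea_zero E).
Local Notation "1" := (ea_one E).

Definition leb x y := [exists z, oplus E x z == Some y].

Lemma lebP x y : reflect (ea_le E x y) (leb x y).
Proof.
by apply: (iffP existsP) => -[z]; [move/eqP|move=> xz]; exists z => //; apply/eqP.
Qed.

Lemma card_ideal_lt x y : ea_le E x y -> x <> y ->
  #|[pred z | leb z x]| < #|[pred z | leb z y]|.
Proof.
move=> xy nxy; apply/proper_card/properP; split.
  by apply/subsetP => z; rewrite !inE => /lebP zx; apply/lebP/(ea_le_trans zx).
exists y; rewrite !inE; first exact/lebP/ea_le_refl.
by apply/lebP => yx; apply/nxy/(ea_le_anti xy).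
Qed.

(** Passing to a strictly smaller element shrinks its principal ideal, so the size of that ideal
    serves as measure. *)
Lemma ea_lt_ind (P : T -> Prop) :
  (forall x, (forall y, ea_le E y x -> y <> x -> P y) -> P x) -> forall x, P x.
Proof.
move=> IH x; have [n] := ubnP #|[pred z | leb z x]|.
elim: n x => // n IHn x xn; apply: IH => y yx nyx; apply: IHn.
exact: leq_trans (card_ideal_lt yx nyx) xn.
Qed.

Lemma ex_atom_le x : x <> 0 -> exists2 a, atom E a & ea_le E a x.
Proof.
elim/ea_lt_ind: x => x IH x0.
have [/existsP[y /and3P[/lebP yx /eqP y0 /eqP nyx]]|/existsPn nex] :=
    boolP [exists y, [&& leb y x, y != 0 & y != x]].
  by have [a aA ay] := IH y yx nyx y0; exists a => //; apply: ea_le_trans yx.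
exists x; last exact: ea_le_refl.
split=> // y yx; have := nex y; rewrite !negb_and !negbK.
by case/or3P => [/lebP//|/eqP ->|/eqP ->]; [left|right].
Qed.

(** * Orthogonal sums of atoms when only 0 and 1 are sharp *)

Section FewSharp.
Hypotheses (homE : homogeneous E)
  (sharpE : forall x : T, sharp E x <-> x = 0 \/ x = 1).

Lemma osum_extend_one s w : {in s, forall a, atom E a} -> s <> [::] ->
  osum E s = Some w ->
  exists2 t, {subset t <= s} & osum E (s ++ t) = Some 1.
Proof.
(* Adding a summand enlarges [w], so the descending induction runs on its supplement. *)
rewrite -(suppK E w); elim/ea_lt_ind: (supp E w) s => {w} r IH s sA s0.
have [w rE] : exists w, r = supp E w by exists (supp E r); rewrite suppK.
rewrite {}rE suppK in IH * => sw.
have [/existsP[a /andP[as_ wa]]|/existsPn nex] :=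
    boolP [exists a, (a \in s) && isSome (oplus E w a)].
  case av: (oplus E w a) wa => [v|//] _.
  have asv : osum E (a :: s) = Some v by rewrite osum_cons sw /= oplus_comm.
  have a0 : a <> 0 by case: (sA a as_).
  have vw : ea_le E (supp E v) (supp E w).
    apply/perpE/perpC; apply: perp_le (oplus_lel av) (ea_le_refl E _) _.
    by apply/perpE; rewrite suppK; apply: ea_le_refl.
  have nvw : supp E v <> supp E w.
    move/(congr1 (supp E)); rewrite !suppK => vE.
    by apply/a0/(oplusI av); rewrite vE oplus0.
  have mem b : b \in a :: s -> b \in s by rewrite inE => /predU1P[->|].
  have [|//| |t ts t1] := IH _ vw nvw (a :: s).
  - by move=> b /mem; apply: sA.
  - by rewrite suppK.
  exists (a :: t); first by move=> b; rewrite inE => /predU1P[->|/ts/mem].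
  by rewrite -t1; apply: osum_perm; rewrite perm_catC /= perm_cons perm_catC.
have nperp a : a \in s -> ~ perp E w a.
  by move=> as_ wa; have := nex a; rewrite as_ -/(perp E w a) wa.
(* The sum is now maximal. An atom below both [w] and its supplement would occur in [s] and be
   orthogonal to [w], so [w] is sharp; it is not 0, as any summand could be added to 0. *)
have /sharpE[w0|w1] : sharp E w.
- split; [exact: ea_le0 | exact: ea_le0 |] => z zw zw'.
  have [->|/eqP z0] := eqVneq z 0; first exact: ea_le_refl.
  have [c cA cz] := ex_atom_le z0.
  have wc : perp E w c by apply/perpC/perpE/(ea_le_trans cz).
  by case: (nperp c (homogeneous_atom_mem homE cA sA sw (ea_le_trans cz zw) wc)).
- case: s s0 {IH sA sw nex} nperp => // a s _ /(_ a).
  by rewrite mem_head w0 /perp oplus_comm oplus0 => /(_ isT).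
- by exists [::] => //; rewrite cats0 sw w1.
Qed.

(** The terms that extend the sum to 1 are all copies of [a], and together they form the
    supplement. *)
Lemma osum_nseq_supp a n w : atom E a -> 0 < n -> osum E (nseq n a) = Some w ->
  exists m, osum E (nseq m a) = Some (supp E w).
Proof.
move=> aA n0 nw; have [| |t ta] := osum_extend_one _ _ nw.
- by move=> b; rewrite mem_nseq => /andP[_ /eqP->].
- by case: n n0 {nw}.
move=> /osum_catP[w1 [v []]]; rewrite nw => -[<-] tv /oplus_suppE <-.
exists (size t); suff /all_pred1P <- : all (pred1 a) t by [].
by apply/allP => b /ta; rewrite mem_nseq => /andP[].
Qed.

Lemma perp_atom_eq a b : atom E a -> atom E b -> perp E a b -> a = b.
Proof.
move=> aA bA ab.
have [//|nab] := eqVneq a b.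
case abw: (oplus E a b) ab => [w|]; last by rewrite /perp abw.
move=> _.
have sA : {in [:: a; b], forall c, atom E c}.
  by move=> c; rewrite !inE => /orP[] /eqP ->.
have [//||t tab] := osum_extend_one sA (w := w).
  by rewrite osum_cons osum_cons osum_nil /= oplus0.
set s := _ ++ t => s1.
have sab : {subset s <= [:: a; b]}.
  by move=> c; rewrite mem_cat => /orP[//|/tab].
(* Group the sum into [i] copies of [a], with sum [x], and [j] copies of [b], with sum [y]. *)
have := s1; rewrite -(osum_perm E (permEl (perm_filterC (pred1 a) s))).
have /all_pred1P -> : all (pred1 a) (filter (pred1 a) s) by apply: filter_all.
have /all_pred1P -> : all (pred1 b) (filter (predC (pred1 a)) s).
  by apply/allP => c; rewrite mem_filter => /andP[/= ca /sab]; rewrite !inE (negbTE ca).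
rewrite !size_filter; set i := count _ _; set j := count _ _.
have i0 : 0 < i by rewrite -has_count; apply/hasP; exists a; rewrite ?mem_head //=.
have j0 : 0 < j.
  rewrite -has_count; apply/hasP; exists b; first by rewrite !inE eqxx orbT.
  by rewrite /= eq_sym.
move=> /osum_catP[x [y [ix jy xy]]].
have yE : y = supp E x by apply/oplus_suppE.
have xE : x = supp E y by rewrite yE suppK.
have [k] := osum_nseq_supp aA i0 ix; rewrite -yE => ky.
have [l] := osum_nseq_supp bA j0 jy; rewrite -xE => lx.
have ax : ea_le E a x by apply: osum_mem_le ix; rewrite mem_nseq i0 eqxx.
have b_y : ea_le E b y by apply: osum_mem_le jy; rewrite mem_nseq j0 eqxx.
have nseqA n c : atom E c -> {in nseq n c, forall d, atom E d}.
  by move=> cA d; rewrite mem_nseq => /andP[_ /eqP ->].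
(* Both [x] and [y] are multiples of [a]. If [x] is the smaller, it is orthogonal to itself, hence
   to [a]; being also a multiple of [b], it forces [a] among the copies of [b]. The other case
   exchanges the roles. *)
have [le_xy|le_yx] := osum_nseq_total ix ky.
- have : a \in nseq l b.
    apply: (homogeneous_atom_mem homE aA (nseqA _ _ bA) lx ax).
    apply: (perp_le (ea_le_refl E x) ax).
    by apply/perpE; rewrite -yE.
  by rewrite mem_nseq => /andP[_ /eqP].
- have : b \in nseq k a.
    apply: (homogeneous_atom_mem homE bA (nseqA _ _ aA) ky b_y).
    apply: (perp_le (ea_le_refl E y) b_y).
    by apply/perpE; rewrite -xE.
  by rewrite mem_nseq => /andP[_ /eqP].
Qed.

(** Remove one [a] from [x]: a nonzero remainder contains an atom orthogonal to [a], which is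
    therefore [a] again. *)
Lemma atom_multiple a x : atom E a -> ea_le E a x ->
  exists n, osum E (nseq n a) = Some x.
Proof.
move=> aA; elim/ea_lt_ind: x => x IH [y ay].
have [y0|/eqP y0] := eqVneq y 0.
  by exists 1%N; rewrite /= osum_cons osum_nil /= -y0.
have [b bA b_y] := ex_atom_le y0.
have ab : a = b.
  by apply: perp_atom_eq => //; apply: perp_le (ea_le_refl E a) b_y _; rewrite /perp ay.
have nyx : y <> x.
  move=> yx; apply: aA.1; move: (oplusC ay); rewrite -yx => ya.
  exact: oplusI ya (oplus0 E y).
have [|n ny] := IH y (oplus_ler ay) nyx; first by rewrite ab.
by exists n.+1; rewrite /= osum_cons ny.
Qed.

(** The supplement of [x] is nonzero and contains an atom, which is orthogonal to every atom below
    [x] and so equal to each of them. *)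
Lemma atom_le_uniq a b x : atom E a -> atom E b ->
  ea_le E a x -> ea_le E b x -> x <> 1 -> a = b.
Proof.
move=> aA bA ax bx x1.
have sx0 : supp E x <> 0 by move=> e; apply: x1; rewrite -(suppK E x) e -supp_one suppK.
have [c cA cx] := ex_atom_le sx0.
have below d : atom E d -> ea_le E d x -> c = d.
  move=> dA dx; apply: perp_atom_eq => //.
  by apply: perp_le cx dx _; apply/perpE/ea_le_refl.
by rewrite -(below a) // -(below b).
Qed.

Lemma incomparable_atoms_lattice x y :
  [\/ ea_le E x y, ea_le E y x | is_meet (ea_le E) x y 0 /\ is_join (ea_le E) x y 1].
Proof.
have [->|/eqP x0] := eqVneq x 0; first by constructor 1; apply: ea_le0.
have [->|/eqP y0] := eqVneq y 0; first by constructor 2; apply: ea_le0.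
have [->|/eqP x1] := eqVneq x 1; first by constructor 2; apply: ea_le1.
have [->|/eqP y1] := eqVneq y 1; first by constructor 1; apply: ea_le1.
have [a aA ax] := ex_atom_le x0; have [b bA b_y] := ex_atom_le y0.
have [ab|/eqP nab] := eqVneq a b.
  rewrite -ab in b_y.
  have [n nx] := atom_multiple aA ax; have [m my] := atom_multiple aA b_y.
  by have [] := osum_nseq_total nx my; [constructor 1|constructor 2].
(* A nonzero common lower bound would contain an atom equal to both [a] and [b]; an upper bound
   other than 1 would lie above two distinct atoms. *)
constructor 3; split; split; try exact: ea_le0; try exact: ea_le1; move=> z.
- move=> zx zy; have [->|/eqP z0] := eqVneq z 0; first exact: ea_le_refl.
  have [c cA cz] := ex_atom_le z0; case: nab.
  rewrite (atom_le_uniq aA cA ax (ea_le_trans cz zx) x1).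
  exact: (atom_le_uniq cA bA (ea_le_trans cz zy) b_y y1).
- move=> xz yz; have [->|/eqP z1] := eqVneq z 1; first exact: ea_le_refl.
  case: nab; exact: (atom_le_uniq aA bA (ea_le_trans ax xz) (ea_le_trans b_y yz) z1).
Qed.

End FewSharp.
End Finite.

Theorem corollary2p4 (T : finType) (E : effectAlgebra T)
    (homE : homogeneous E)
    (sharpE : forall x : T, sharp E x <-> x = ea_zero E \/ x = ea_one E) :
  is_lattice (ea_le E).
Proof.
split=> [|x y]; first exact: ea_le_order.
have [xy|yx|[meet0 join1]] := incomparable_atoms_lattice homE sharpE x y.
- by split; [exists x|exists y]; split=> //; apply: ea_le_refl.
- by split; [exists y|exists x]; split=> //; apply: ea_le_refl.
- by split; [exists (ea_zero E)|exists (ea_one E)].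
Qed.
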